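(* Let $\mathcal R$ be a term rewriting system over a signature $\Sigma$, let $G$ be an E-graph over $\Sigma$, and let $\mathcal C_G$ be the class of E-graphs $G'$ with $G \sqsubseteq G'$. Then the operator $\mathrm{ICO}_{\mathcal R} : \mathcal C_G \to \mathcal C_G$ has a least fixpoint (with respect to $\sqsubseteq$, E-graphs being considered up to isomorphism), given by $$\mathrm{EqSat}(\mathcal R, G) := \bigsqcup_{i \ge 0} \mathrm{ICO}_{\mathcal R}^{(i)}(G),$$ where $\bigsqcup$ denotes the least upper bound with respect to $\sqsubseteq$. Furthermore, $\mathrm{EqSat}(\mathcal R, G)$ is a universal model of $\mathcal R, G$.
   Context: A signature $\Sigma$ is a finite set of function symbols with arities. $T(\Sigma,V)$ is the set of terms (patterns) over $\Sigma$ with variables in $V$; $T(\Sigma)$ is the set of ground terms. A term rewriting system (TRS) $\mathcal R$ is a set of rules $\mathit{lhs}\to\mathit{rhs}$ between patterns with $\mathrm{Var}(\mathit{rhs})\subseteq \mathrm{Var}(\mathit{lhs})$. A (bottom-up) tree automaton $\mathcal A=\langle Q,\Sigma,\Delta\rangle$ (no final states needed here) has a possibly infinite set $Q$ of states and a possibly infinite set $\Delta$ of transitions $f(q_1,\dots,q_n)\to q$ with $f\in\Sigma$ of arity $n$ and $q_i,q\in Q$. Viewing states as nullary symbols, $\to^*_{\mathcal A}$ is the reflexive-transitive closure of rewriting by $\Delta$ on $T(\Sigma\cup Q)$. $\mathcal A$ is deterministic if $t\to^*_{\mathcal A}q_1$ and $t\to^*_{\mathcal A}q_2$ (with $t\in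 T(\Sigma)$, $q_1,q_2\in Q$) imply $q_1=q_2$; it is reachable if for every $q\in Q$ there is $t\in T(\Sigma)$ with $t\to^*_{\mathcal A}q$. An E-graph is a deterministic and reachable tree automaton (possibly infinite). A homomorphism $h:\mathcal A\to\mathcal B$ is a map of states such that for every transition $f(c_1,\dots,c_k)\to c$ of $\mathcal A$, $f(h(c_1),\dots,h(c_k))\to h(c)$ is a transition of $\mathcal B$. $\mathcal A\sqsubseteq\mathcal B$ means there is a homomorphism $\mathcal A\to\mathcal B$; on E-graphs this is a partial order up to isomorphism. For a reachable tree automaton $\mathcal A$, the congruence closure $\mathrm{CC}(\mathcal A)$ is the (unique up to isomorphism) E-graph with $\mathcal A\sqsubseteq \mathrm{CC}(\mathcal A)$ such that $\mathcal A\sqsubseteq G'$ implies $\mathrm{CC}(\mathcal A)\sqsubseteq G'$ for every E-graph $G'$. For an E-graph $G=\langle Q,\Sigma,\Delta\rangle$, a match is a rule $\mathit{lhs}\to\mathit{rhs}$ in $\mathcal R$, a substitution $\sigma:\mathrm{Var}(\mathit{lhs})\to Q$ and a state $c\in Q$ with $\mathit{lhs}[\sigma]\to^*_G c$. $T_{\mathcal R}(G)$ is the tree automaton obtained from $G$ by adding, for every match, the flattening of $t=\mathit{rhs}[\sigma]\in T(\Sigma\cup Q)$ with root $c$: put $q_t=c$, $q_u=u$ for subterms $u\in Q$, take a fresh state $q_u$ for every other proper subterm $u$ of $t$, and add the transition $f(q_{u_1},\dots,q_{u_k})\to q_u$ for every subterm $u=f(u_1,\dots,u_k)$ of $t$ with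 $f\in\Sigma$; if $t$ is itself a state $c'$ (i.e. $\mathit{rhs}$ is a variable), then $c'$ and $c$ are identified. The immediate consequence operator is $\mathrm{ICO}_{\mathcal R}=\mathrm{CC}\circ T_{\mathcal R}$, and $\mathrm{ICO}^{(i)}_{\mathcal R}$ is its $i$-fold iterate. An E-graph $H=\langle Q,\Sigma,\Delta\rangle$ is a model of $\mathcal R$ if for every rule $\mathit{lhs}\to\mathit{rhs}$ in $\mathcal R$, every $\sigma:\mathrm{Var}(\mathit{lhs})\to Q$ and every $c\in Q$, $\mathit{lhs}[\sigma]\to^*_H c$ implies $\mathit{rhs}[\sigma]\to^*_H c$. $H$ is a model of $\mathcal R,G$ if $G\sqsubseteq H$ and $H$ is a model of $\mathcal R$; it is a universal model if moreover $H\sqsubseteq H'$ for every model $H'$ of $\mathcal R,G$. *)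

(* Defs.v *)
From HB Require Import structures.
From Stdlib Require Import Relation_Operators Operators_Properties.
From mathcomp Require Import all_boot.
From mathcomp Require Import boolp classical_sets.

Set Implicit Arguments.
Unset Strict Implicit.
Unset Printing Implicit Defensive.

Local Open Scope classical_set_scope.
Local Open Scope quotient_scope.

Record signature := Signature { symb :> finType; arity : symb -> nat }.

(* [term S V] is T(S, V), and also T(S U Q) when the leaves are taken in a set
   of states Q: a state q seen as a nullary symbol is [Var q]. *)
Inductive term (S : signature) (V : Type) : Type :=
| Var of V
| App (f : S) of ('I_(arity f) -> term S V).

Arguments Var {S V}.
Arguments App {S V}.

Definition ground_term (S : signature) := term S void.

Section Terms.
Variable S : signature.

Fixpoint map_leaves (V W : Type) (h : V -> W) (t : term S V) : term S W :=
  match t with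
  | Var v => Var (h v)
  | App f a => App f (fun i => map_leaves h (a i))
  end.

Definition ground_in (V : Type) : ground_term S -> term S V :=
  map_leaves (of_void V).

Fixpoint vars (V : Type) (t : term S V) : set V :=
  match t with
  | Var v => [set v]
  | App f a => \bigcup_i vars (a i)
  end.

Definition restrict (V W : Type) (A B : set V) (AB : A `<=` B) (s : B -> W) :
    A -> W :=
  fun v => s (SigSub (mem_set (AB _ (set_valP v)))).

(* t[s], for s defined on the variables of t only *)
Fixpoint inst (V W : Type) (t : term S V) : (vars t -> W) -> term S W :=
  match t with
  | Var v => fun s => Var (s (SigSub (mem_set (erefl v))))
  | App f a => fun s =>
      App f (fun i => inst (restrict (@bigcup_sup _ _ i setT _ I) s))
  end.

Inductive subterm (V : Type) (u : term S V) : term S V -> Prop :=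
| subterm_refl : subterm u u
| subterm_arg f a i : subterm u (a i) -> subterm u (App f a).

End Terms.

Record trs (S : signature) (V : Type) := TRS {
  rules : set (term S V * term S V);
  rules_vars : forall l r, rules (l, r) -> vars r `<=` vars l
}.

Record automaton (S : signature) := Automaton {
  state : Type;
  trans : forall f : S, ('I_(arity f) -> state) -> state -> Prop
}.

Section Automata.
Variable S : signature.
Implicit Types A B C : automaton S.

Inductive step A : term S (state A) -> term S (state A) -> Prop :=
| step_trans f qs q : @trans S A f qs q ->
    step (App f (fun i => Var (qs i))) (Var q)
| step_arg f a b i : step (a i) (b i) -> (forall j, j <> i -> a j = b j) ->
    step (App f a) (App f b).

Definition rewrites A : term S (state A) -> term S (state A) -> Prop :=
  clos_refl_trans _ (@step A).

Definition deterministic A := forall (t : ground_term S) (q1 q2 : state A),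
  rewrites (ground_in _ t) (Var q1) -> rewrites (ground_in _ t) (Var q2) ->
  q1 = q2.

Definition reachable A := forall q : state A,
  exists t : ground_term S, rewrites (ground_in _ t) (Var q).

Definition is_hom A B (h : state A -> state B) :=
  forall f qs q, @trans S A f qs q -> trans (h \o qs) (h q).

Definition hom_le A B := exists h : state A -> state B, is_hom h.

Definition isomorphic A B := exists (h : state A -> state B) k,
  [/\ is_hom h, is_hom k, cancel h k & cancel k h].

End Automata.

Notation "A [<=] B" := (hom_le A B) (at level 70).
Notation "A [~=] B" := (isomorphic A B) (at level 70).

Record egraph (S : signature) := EGraph {
  egraph_aut :> automaton S;
  egraph_det : deterministic egraph_aut;
  egraph_reach : reachable egraph_aut
}.

Section Evaluation.
Variable S : signature.
Implicit Types A B : automaton S.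

Inductive eval A : term S (state A) -> state A -> Prop :=
| eval_var q : eval (Var q) q
| eval_app f a qs q : (forall i, eval (a i) (qs i)) -> @trans S A f qs q ->
    eval (App f a) q.

Lemma eval_VarE A (x q : state A) : eval (Var x) q -> x = q.
Proof.
move=> H; by inversion H.
Qed.

Lemma eval_AppE A f (a : 'I_(arity f) -> term S (state A)) q :
  eval (App f a) q ->
  exists2 qs, (forall i, eval (a i) (qs i)) & trans qs q.
Proof.
move=> H; pose P (t : term S (state A)) q := match t with
  | Var _ => True
  | App f a => exists2 qs, (forall i, eval (a i) (qs i)) & trans qs q end.
rewrite -/(P (App f a) q); case: H => //= g b qs p Hb Hp; by exists qs.
Qed.

Lemma step_eval A (t u : term S (state A)) q : step t u -> eval u q -> eval t q.
Proof.
move=> st; elim: st q => [f qs p tp|f a b i _ IH Hab] q.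
  by move=> /eval_VarE <-; apply: eval_app tp => i; apply: eval_var.
move=> /eval_AppE [qs Hqs tq]; apply: eval_app tq => j.
have [->|/eqP ne] := eqVneq j i; first exact: IH.
by rewrite Hab.
Qed.

Lemma rewrites_eval A (t : term S (state A)) q : rewrites t (Var q) -> eval t q.
Proof.
move=> /clos_rt_rt1n_iff; move E: (Var q) => u H.
elim: H E => [? <-|x y z st _ IH E]; first exact: eval_var.
by apply: step_eval st (IH E).
Qed.

Lemma rewrites_arg A f (a b : 'I_(arity f) -> term S (state A)) i :
  rewrites (a i) (b i) -> (forall j, j <> i -> a j = b j) ->
  rewrites (App f a) (App f b).
Proof.
move=> H ne.
pose c x j := if j == i then x else a j.
have ca : c (a i) = a by apply: funext => j; rewrite /c; case: eqP => [->|].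
have cb : c (b i) = b.
  by apply: funext => j; rewrite /c; case: eqP => [->|/ne].
rewrite -{1}ca -{1}cb; elim: H => [x y st|x|x y z _ H1 _ H2].
- apply: rt_step; apply: (@step_arg _ _ _ _ _ i); first by rewrite /c eqxx.
  by move=> j /eqP/negPf ji; rewrite /c ji.
- exact: rt_refl.
- exact: rt_trans H1 H2.
Qed.

Lemma rewrites_args A f (a b : 'I_(arity f) -> term S (state A)) :
  (forall i, rewrites (a i) (b i)) -> rewrites (App f a) (App f b).
Proof.
move=> H; pose c n (j : 'I_(arity f)) := if j < n then b j else a j.
have Hc n : n <= arity f -> rewrites (App f a) (App f (c n)).
  elim: n => [_|n IH nf].
    by rewrite (_ : c 0 = a); [exact: rt_refl | apply: funext].
  apply: rt_trans (IH (ltnW nf)) _.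
  apply: (@rewrites_arg _ _ _ _ (Ordinal nf)).
    by rewrite /c /= ltnn ltnSn.
  move=> j jn; rewrite /c [j < n.+1]ltnS [j <= n]leq_eqVlt.
  by case: eqP => //= E; case: jn; apply: val_inj.
have := Hc _ (leqnn _); rewrite (_ : c _ = b) //.
by apply: funext => j; rewrite /c ltn_ord.
Qed.

Lemma rewrites_app A f (a : 'I_(arity f) -> term S (state A)) qs q :
  (forall i, rewrites (a i) (Var (qs i))) -> trans qs q ->
  rewrites (App f a) (Var q).
Proof.
move=> H tq; apply: rt_trans (rewrites_args H) _.
by apply: rt_step; apply: step_trans.
Qed.

Lemma ground_App A f (ts : 'I_(arity f) -> ground_term S) qs (q : state A) :
  (forall i, rewrites (ground_in _ (ts i)) (Var (qs i))) -> trans qs q ->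
  rewrites (ground_in _ (App f ts)) (Var q).
Proof. exact: rewrites_app. Qed.

Lemma step_hom A B (h : state A -> state B) t u : is_hom h ->
  step t u -> step (map_leaves h t) (map_leaves h u).
Proof.
move=> hh; elim=> [f qs q tq|f a b i _ IH ne] /=.
  by apply: (@step_trans _ _ _ (h \o qs)); apply: hh.
by apply: step_arg IH _ => j /ne ->.
Qed.

Lemma rewrites_hom A B (h : state A -> state B) t u : is_hom h ->
  rewrites t u -> rewrites (map_leaves h t) (map_leaves h u).
Proof.
move=> hh; elim=> [x y /(step_hom hh)|x|x y z _ H1 _ H2].
- exact: rt_step.
- exact: rt_refl.
- exact: rt_trans H1 H2.
Qed.

Lemma map_ground V W (h : V -> W) (t : ground_term S) :
  map_leaves h (ground_in V t) = ground_in W t.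
Proof.
elim: t => [[]|f a IH] /=; congr App; apply: funext => i; exact: IH.
Qed.

Lemma ground_hom A B (h : state A -> state B) (t : ground_term S) q :
  is_hom h -> rewrites (ground_in _ t) (Var q) ->
  rewrites (ground_in _ t) (Var (h q)).
Proof. by move=> hh /(rewrites_hom hh); rewrite map_ground. Qed.

Lemma trans_fun_det A :
  (forall f (qs : 'I_(arity f) -> state A) q1 q2,
     trans qs q1 -> trans qs q2 -> q1 = q2) ->
  deterministic A.
Proof.
move=> fA t q1 q2 /rewrites_eval e1 /rewrites_eval e2.
elim: {t}(ground_in _ t) q1 q2 e1 e2 => [x|f a IH] q1 q2.
  by move=> /eval_VarE <- /eval_VarE.
move=> /eval_AppE [ps Hps t1] /eval_AppE [qs Hqs t2].
suff E : ps = qs by subst qs; apply: fA t1 t2.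
by apply: funext => i; apply: IH.
Qed.

Lemma egraph_trans_fun (G : egraph S) f (qs : 'I_(arity f) -> state G) q1 q2 :
  trans qs q1 -> trans qs q2 -> q1 = q2.
Proof.
move=> t1 t2; have [ts Hts] := choice (fun i => @egraph_reach _ G (qs i)).
by apply: (@egraph_det _ G (App f ts)); apply: ground_App Hts _.
Qed.

End Evaluation.

Section Identification.
Variables (S : signature) (A : automaton S) (r : state A -> state A -> Prop).

Let same (x y : {classic state A}) := `[< clos_refl_sym_trans _ r x y >].

Let same_refl : reflexive same.
Proof. by move=> x; apply/asboolP/rst_refl. Qed.

Let same_sym : symmetric same.
Proof. by move=> x y; apply: asbool_equiv_eq; split=> H; apply: rst_sym. Qed.

Let same_trans : transitive same.
Proof.
by move=> y x z /asboolP xy /asboolP yz; apply/asboolP; apply: rst_trans xy yz.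
Qed.

Definition same_equiv : equiv_rel {classic state A} :=
  EquivRel same same_refl same_sym same_trans.

Definition ident_class (q : state A) : {eq_quot same_equiv} :=
  \pi_({eq_quot same_equiv}) (q : {classic state A}).

(* A with the states related by r identified *)
Definition identify : automaton S := {|
  state := {eq_quot same_equiv};
  trans := fun f qs q => exists ps p,
    [/\ trans ps p, qs = (@ident_class \o ps) :> ('I_(arity f) -> _)
      & q = ident_class p]
|}.

Lemma ident_classP x y :
  ident_class x = ident_class y <-> clos_refl_sym_trans _ r x y.
Proof.
split=> [/eqmodP /asboolP H|H]; first exact: H.
by apply/eqmodP; apply/asboolP.
Qed.

Lemma ident_class_surj (c : state identify) : exists q, c = ident_class q.
Proof. by exists (repr c); rewrite /ident_class reprK. Qed.

Lemma ident_class_hom : @is_hom S A identify ident_class.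
Proof. by move=> f qs q tq; exists qs, q. Qed.

Lemma identify_reachable : reachable A -> reachable identify.
Proof.
move=> rA c; have [q ->] := ident_class_surj c; have [t Ht] := rA q.
by exists t; apply: (ground_hom (B := identify)) ident_class_hom Ht.
Qed.

End Identification.

Section CongruenceClosure.
Variable S : signature.
Implicit Types A B : automaton S.

Definition is_CC A (C : egraph S) :=
  A [<=] C /\ forall G' : egraph S, A [<=] G' -> C [<=] G'.

Inductive cong A : state A -> state A -> Prop :=
| cong_refl q : cong q q
| cong_sym p q : cong p q -> cong q p
| cong_trans p q s : cong p q -> cong q s -> cong p s
| cong_app f ps qs p q : (forall i, cong (ps i) (qs i)) ->
    @trans S A f ps p -> trans qs q -> cong p q.

Lemma rst_cong A (p q : state A) :
  clos_refl_sym_trans _ (@cong A) p q <-> cong p q.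
Proof.
split=> [|?]; last exact: rst_step.
elim=> [//|||]; [exact: cong_refl|by move=> ? ? _; exact: cong_sym|].
by move=> x y z _ H1 _ H2; apply: cong_trans H1 H2.
Qed.

Lemma cong_class A (p q : state A) :
  ident_class (@cong A) p = ident_class (@cong A) q <-> cong p q.
Proof. by rewrite ident_classP rst_cong. Qed.

Lemma cong_hom A (G : egraph S) (h : state A -> state G) p q :
  is_hom h -> cong p q -> h p = h q.
Proof.
move=> hh; elim=> [//|? ? _ ->//|? ? ? _ -> _ ->//|f ps qs {}p {}q _ E tp tq].
have {}E : h \o ps = h \o qs by apply: funext.
by apply: egraph_trans_fun (hh _ _ _ tp) _; rewrite E; apply: hh.
Qed.

Lemma CC_exists A : reachable A -> exists C : egraph S, is_CC A C.
Proof.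
move=> rA.
have dC : deterministic (identify (@cong A)).
  apply: trans_fun_det => f qs q1 q2 [ps1 [p1 [t1 E1 ->]]] [ps2 [p2 [t2 E2 ->]]].
  apply/cong_class; apply: cong_app t1 t2 => i; apply/cong_class.
  exact: (congr1 (fun g => g i) (etrans (esym E1) E2)).
exists (EGraph dC (identify_reachable (r := @cong A) rA)); split.
  by exists (ident_class (@cong A)); apply: ident_class_hom.
move=> G' [h hh].
pose rep (c : state (identify (@cong A))) : state A := repr c.
have repE q : h (rep (ident_class (@cong A) q)) = h q.
  apply: (cong_hom hh); apply/cong_class.
  by rewrite {1}/ident_class /rep reprK.
exists (h \o rep) => f qs q [ps [p [tp -> ->]]] /=.
rewrite repE (_ : _ \o _ = h \o ps); first exact: hh.
by apply: funext => i /=; rewrite repE.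
Qed.

(* Determined up to isomorphism only, by its universal property [CC_spec]. *)
Definition CC A (rA : reachable A) : egraph S := sval (cid (CC_exists rA)).

Lemma CC_spec A (rA : reachable A) : is_CC A (CC rA).
Proof. exact: svalP (cid (CC_exists rA)). Qed.

End CongruenceClosure.

Section ImmediateConsequence.
Variables (S : signature) (V : Type) (R : trs S V).

Record ematch (G : automaton S) := EMatch {
  m_lhs : term S V;
  m_rhs : term S V;
  m_rule : rules R (m_lhs, m_rhs);
  m_subst : vars m_lhs -> state G;
  m_root : state G;
  m_holds : rewrites (inst m_subst) (Var m_root)
}.

Section Flattening.
Variable G : automaton S.
Implicit Type m : ematch G.

Definition m_term m : term S (state G) :=
  inst (restrict (rules_vars (m_rule m)) (@m_subst _ m)).

Definition fresh m : set (term S (state G)) :=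
  [set u | [/\ subterm u (m_term m), u <> m_term m & forall q, u <> Var q]].

Definition flat_state : Type := state G + {m : ematch G & fresh m}.

(* [node m u s] means that s is the state q_u attached to u by the flattening
   of [m_term m]; fresh states are private to the match m. *)
Inductive node m : term S (state G) -> flat_state -> Prop :=
| node_root : node m (m_term m) (inl (m_root m))
| node_state q : Var q <> m_term m -> node m (Var q) (inl q)
| node_fresh (u : fresh m) : node m (val u) (inr (existT _ m u)).

Inductive flat_trans (f : S) (qs : 'I_(arity f) -> flat_state) :
    flat_state -> Prop :=
| flat_old ps p : trans ps p -> qs = inl \o ps -> flat_trans qs (inl p)
| flat_new m us s : subterm (App f us) (m_term m) ->
    (forall i, node m (us i) (qs i)) -> node m (App f us) s -> flat_trans qs s.

Definition flat : automaton S := Automaton flat_trans.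

(* right-hand sides that are variables *)
Definition flat_ident (x y : flat_state) := exists m c,
  [/\ m_term m = Var c, x = inl c & y = inl (m_root m)].

Definition T : automaton S := identify (A := flat) flat_ident.

Lemma subterm_App f us (t : term S (state G)) i :
  subterm (App f us) t -> subterm (us i) t.
Proof.
elim=> [|g a j _ IH]; first exact/subterm_arg/subterm_refl.
exact: subterm_arg IH.
Qed.

Lemma flat_reachable : reachable G -> reachable flat.
Proof.
move=> rG.
have rold q : exists t, rewrites (A := flat) (ground_in _ t) (Var (inl q)).
  have [t Ht] := rG q; exists t.
  apply: (ground_hom (B := flat) (h := inl)) Ht => f qs p tp.
  exact: flat_old tp _.
case=> [//|[m u]].
have : node m (val u) (inr (existT _ m u)) by exact: node_fresh.
have : subterm (val u) (m_term m) by case: (set_valP u).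
move: (inr _) => s; elim: (val u) s => [q|f us IH] s sub nd.
  suff [p ->] : exists p, s = inl p by [].
  move E: (Var q) nd => w nd; case: nd E => [_|p _ _|v E].
  - by exists (m_root m).
  - by exists p.
  - by case: (set_valP v) => _ _ /(_ q); rewrite -E.
have nodeE i : exists s', node m (us i) s'.
  have [->|ne] := pselect (us i = m_term m).
    by exists (inl (m_root m)); apply: node_root.
  case E : (us i) => [q|g a].
    by exists (inl q); apply: node_state; rewrite -E.
  have fr : fresh m (us i).
    by split=> //; [exact: subterm_App sub | move=> q; rewrite E].
  exists (inr (existT _ m (SigSub (mem_set fr)))); rewrite -E.
  exact: (node_fresh (SigSub (mem_set fr))).
have [qs Hqs] := choice nodeE.
have [ts Hts] := choice (fun i => IH i (qs i) (subterm_App i sub) (Hqs i)).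
exists (App f ts); apply: (ground_App (A := flat)) Hts _.
exact: flat_new sub Hqs nd.
Qed.

Lemma T_reachable : reachable G -> reachable T.
Proof. by move=> /flat_reachable; apply: identify_reachable. Qed.

End Flattening.

Definition ICO (G : egraph S) : egraph S :=
  CC (T_reachable (@egraph_reach S G)).

Definition is_model_of_trs (H : egraph S) :=
  forall l r (lr : rules R (l, r)) (s : vars l -> state H) (c : state H),
    rewrites (inst s) (Var c) ->
    rewrites (inst (restrict (rules_vars lr) s)) (Var c).

Definition is_model (G H : egraph S) := G [<=] H /\ is_model_of_trs H.

Definition is_universal_model (G H : egraph S) :=
  is_model G H /\ forall H' : egraph S, is_model G H' -> H [<=] H'.

End ImmediateConsequence.

Definition is_lub (S : signature) (Gs : nat -> egraph S) (E : egraph S) :=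
  (forall i, Gs i [<=] E) /\
  forall H : egraph S, (forall i, Gs i [<=] H) -> E [<=] H.

(* fixpoints in the class of E-graphs above G, up to isomorphism *)
Definition is_fixpoint (S : signature) (F : egraph S -> egraph S)
    (G E : egraph S) :=
  G [<=] E /\ F E [~=] E.

Definition is_least_fixpoint (S : signature) (F : egraph S -> egraph S)
    (G E : egraph S) :=
  is_fixpoint F G E /\ forall H : egraph S, is_fixpoint F G H -> E [<=] H.

Definition is_EqSat (S : signature) (V : Type) (R : trs S V)
    (G E : egraph S) :=
  is_lub (fun i => iter i (ICO R) G) E.

(* Main.v *)
(* An E-graph G is determined up to isomorphism by the relation [sim G] "t and u
   evaluate to the same state" on ground terms, which is a partial congruence
   whose domain is closed under subterms; conversely every such relation arises
   from an E-graph, and G [<=] H amounts to [sim G] being contained in [sim H].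
   Under this dictionary ICO(G) [<=] H says that G [<=] H and that, for every
   rule l -> r and every ground substitution, whatever G identifies with the
   instance of l is identified by H with the instance of r.  Hence ICO is
   inflationary and monotone, and its pre-fixpoints are the models of R.  The
   least upper bound of a chain is the union of its relations, so every instance
   of a left-hand side that holds in EqSat already holds at a finite stage i, and
   the corresponding right-hand side holds at stage i + 1. *)
Require Import Defs.
From mathcomp Require Import all_boot.
From mathcomp Require Import boolp classical_sets.

Set Implicit Arguments.
Unset Strict Implicit.
Unset Printing Implicit Defensive.

(** * Ground evaluation and the order on E-graphs *)

Section GroundEvaluation.
Variable S : signature.
Implicit Types (A B : automaton S) (G H : egraph S) (t u : ground_term S).

Definition geval A t (q : state A) := eval (ground_in _ t) q.

Lemma eval_rewrites A (t : term S (state A)) q : eval t q -> rewrites t (Var q).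
Proof.
elim=> [p|f a qs p _ IH tp]; first exact: Relation_Operators.rt_refl.
exact: rewrites_app IH tp.
Qed.

Lemma eval_hom A B (h : state A -> state B) (t : term S (state A)) q :
  is_hom h ->
  eval t q -> eval (map_leaves h t) (h q).
Proof.
by move=> hh /eval_rewrites /(rewrites_hom hh) /rewrites_eval.
Qed.

Lemma geval_hom A B (h : state A -> state B) t q : is_hom h ->
  geval t q -> geval t (h q).
Proof. by move=> hh /(eval_hom hh); rewrite map_ground. Qed.

Lemma geval_app A f ts (qs : 'I_(arity f) -> state A) q :
  (forall i, geval (ts i) (qs i)) -> trans qs q -> geval (App f ts) q.
Proof. exact: eval_app. Qed.

Lemma eval_inj G (t : term S (state G)) p q : eval t p -> eval t q -> p = q.
Proof.
elim: t p q => [x|f a IH] p q; first by move=> /eval_VarE <- /eval_VarE.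
move=> /eval_AppE [ps eps tp] /eval_AppE [qs eqs tq].
have E : ps = qs by apply: funext => i; apply: IH.
by subst qs; apply: egraph_trans_fun tp tq.
Qed.

Lemma geval_ex G (q : state G) : exists t, geval t q.
Proof. by have [t /rewrites_eval] := @egraph_reach _ G q; exists t. Qed.

Definition sim A t u := exists2 q : state A, geval t q & geval u q.

(** For the converse, every state [q] is the value of some ground term [tm q], and [h q] is the
    value of [tm q] in [H]. Any other term with value [q] also has value [h q] in [H], which makes
    [h] a homomorphism. *)
Lemma sim_leP G H : G [<=] H <-> forall t u, sim G t u -> sim H t u.
Proof.
split=> [[h hh] t u [q tq uq]|GH].
  by exists (h q); apply: geval_hom.
have [tm tmP] := choice (@geval_ex G).
have ex q : exists p : state H, geval (tm q) p.
  by have [|p] := GH (tm q) (tm q); [exists q | exists p].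
have [h hP] := choice ex.
have gh t q : geval t q -> geval t (h q).
  move=> tq; have [|p tp tmp] := GH t (tm q); first by exists q.
  by rewrite (eval_inj (hP q) tmp).
exists h => f qs q tq.
have /eval_AppE [ps eps tp] : geval (App f (tm \o qs)) (h q).
  by apply: gh; apply: geval_app tq => i; apply: tmP.
suff -> : h \o qs = ps by [].
by apply: funext => i; apply: eval_inj (eps i); apply: hP.
Qed.

Lemma hom_le_refl A : A [<=] A.
Proof. by exists id. Qed.

Lemma hom_le_trans A B C : A [<=] B -> B [<=] C -> A [<=] C.
Proof. by case=> h hh [k kk]; exists (k \o h) => f qs q /hh /kk. Qed.

(** Every state is the value of a ground term, and homomorphisms preserve such values. *)
Lemma hom_uniq G H (h k : state G -> state H) : is_hom h -> is_hom k -> h =1 k.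
Proof.
move=> hh kk q; have [t tq] := geval_ex q.
by apply: eval_inj (geval_hom hh tq) (geval_hom kk tq).
Qed.

Lemma hom_le_anti G H : G [<=] H -> H [<=] G -> G [~=] H.
Proof.
move=> [h hh] [k kk]; exists h, k; split=> // q.
  apply: (@hom_uniq G G (k \o h) id) => // f qs p tp; exact: kk (hh _ _ _ tp).
apply: (@hom_uniq H H (h \o k) id) => // f qs p tp; exact: hh (kk _ _ _ tp).
Qed.

Lemma iso_hom_le A B : A [~=] B -> A [<=] B /\ B [<=] A.
Proof. by move=> [h [k [hh kk _ _]]]; split; [exists h|exists k]. Qed.

(** * Partial congruences and the E-graphs they define *)

Record pcongruence (r : ground_term S -> ground_term S -> Prop) : Prop := {
  pcong_sym t u : r t u -> r u t;
  pcong_trans t u v : r t u -> r u v -> r t v;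
  pcong_arg f ts i : r (App f ts) (App f ts) -> r (ts i) (ts i);
  pcong_app f ts us : (forall i, r (ts i) (us i)) ->
    r (App f ts) (App f ts) -> r (App f ts) (App f us)
}.

Lemma sim_pcongruence G : pcongruence (sim G).
Proof.
split.
- by move=> t u [q]; exists q.
- by move=> t u v [q tq uq] [p up vp]; exists q; rewrite // (eval_inj uq up).
- by move=> f ts i [q /eval_AppE [qs eqs _] _]; exists (qs i); apply: eqs.
move=> f ts us tu [q eq _]; exists q => //.
have /eval_AppE [qs eqs tq] := eq; apply: geval_app tq => i.
by have [p tp up] := tu i; rewrite (eval_inj (eqs i) tp).
Qed.

Section TermModel.
Variable r : ground_term S -> ground_term S -> Prop.
Hypothesis rP : pcongruence r.

(** States are the classes of [r] as sets of terms; a term outside the domain of [r] lies in none of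
    them. *)
Let cls := {P : set (ground_term S) | exists2 t, r t t & P = r t}.

Let clsE (P : cls) t : sval P t -> sval P = r t /\ r t t.
Proof.
case: P => P [v rvv PE] /=; rewrite {P}PE => rvt; split; last first.
  exact: (pcong_trans rP (pcong_sym rP rvt) rvt).
apply/seteqP; split=> u; apply: (pcong_trans rP) => //.
exact: (pcong_sym rP).
Qed.

Let cls_ex t : r t t -> exists P : cls, sval P t.
Proof. by move=> rt; exists (exist _ (r t) (ex_intro2 _ _ t rt erefl)). Qed.

Definition term_model : automaton S := {|
  state := cls;
  trans := fun f qs q => exists2 ts, forall i, sval (qs i) (ts i)
    & sval q (App f ts)
|}.

Let term_model_geval t (q : state term_model) : geval t q <-> sval q t.
Proof.
elim: t q => [[]|f ts IH] q; split.
  move=> /eval_AppE [qs eqs [us qsu qu]].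
  have [qE ruu] := clsE qu; rewrite qE.
  apply: pcong_app => // i; have [<- _] := clsE (qsu i).
  by apply/IH; apply: eqs.
move=> qt; have [_ rtt] := clsE qt.
have [qs qsP] := choice (fun i => cls_ex (pcong_arg rP i rtt)).
by apply: (@geval_app term_model _ _ qs); [move=> i; apply/IH | exists ts].
Qed.

Lemma pcongruence_sim : exists G : egraph S, forall t u, sim G t u <-> r t u.
Proof.
have det : deterministic term_model.
  move=> t q1 q2 /rewrites_eval /term_model_geval e1.
  move=> /rewrites_eval /term_model_geval e2.
  have {e1 e2} : sval q1 = sval q2 by rewrite (clsE e1).1 (clsE e2).1.
  by case: q1 q2 => [P1 ?] [P2 ?]; apply: eq_exist.
have reach : reachable term_model.
  move=> q; case: (svalP q) => t rtt qE; exists t.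
  by apply: eval_rewrites; apply/term_model_geval; rewrite qE.
exists (EGraph det reach) => t u; split.
  by move=> [q /term_model_geval qt /term_model_geval]; rewrite (clsE qt).1.
move=> rtu; have [|q qt] := @cls_ex t.
  exact: (pcong_trans rP rtu (pcong_sym rP rtu)).
by exists q; apply/term_model_geval; rewrite // (clsE qt).1.
Qed.

End TermModel.

(** * Least upper bounds of increasing chains *)

Section Chain.
Variable Gs : nat -> egraph S.
Hypothesis GsS : forall i, Gs i [<=] Gs i.+1.

Lemma chain_sim_mono i j t u : i <= j -> sim (Gs i) t u -> sim (Gs j) t u.
Proof.
move=> /subnKC <-; elim: (j - i) => [|n IH]; rewrite ?addn0 // addnS => /IH.
exact: (sim_leP _ _).1.
Qed.

Lemma chain_pcongruence : pcongruence (fun t u => exists i, sim (Gs i) t u).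
Proof.
split.
- by move=> t u [i tu]; exists i; apply: (pcong_sym (sim_pcongruence _)).
- move=> t u v [i tu] [j uv]; exists (maxn i j).
  apply: (pcong_trans (sim_pcongruence _)).
    exact: chain_sim_mono (leq_maxl i j) tu.
  exact: chain_sim_mono (leq_maxr i j) uv.
- move=> f ts i [j tt]; exists j; exact: (pcong_arg (sim_pcongruence _) i tt).
(* Arities are finite, so one stage [m] bounds the stages of all arguments. *)
move=> f ts us /choice [n nP] [j tt]; pose m := maxn j (\max_i n i).
exists m; apply: (pcong_app (sim_pcongruence _)) => [i|].
  apply: chain_sim_mono (nP i); apply: leq_trans (leq_maxr _ _).
  exact: leq_bigmax.
by apply: chain_sim_mono tt; apply: leq_maxl.
Qed.

Lemma chain_lub_exists : exists E : egraph S, is_lub Gs E.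
Proof.
have [E simE] := pcongruence_sim chain_pcongruence; exists E; split=> [i|H GH].
  by apply/sim_leP => t u tu; apply/simE; exists i.
by apply/sim_leP => t u /simE [i]; move: t u; apply/sim_leP.
Qed.

(** The E-graph [L] of the union is an upper bound, so minimality of [E] gives [E [<=] L]. *)
Lemma chain_lub_sim (E : egraph S) t u :
  is_lub Gs E -> sim E t u -> exists i, sim (Gs i) t u.
Proof.
have [L simL] := pcongruence_sim chain_pcongruence.
move=> [_ Emin] tu; apply/simL; move: t u tu; apply/sim_leP; apply: Emin => i.
by apply/sim_leP => t u tu; apply/simL; exists i.
Qed.

End Chain.

End GroundEvaluation.

(** * Ground instances of patterns *)

Section GroundInstances.
Variables (S : signature) (V : Type).

Fixpoint join_ground (t : term S (ground_term S)) : ground_term S :=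
  match t with
  | Var g => g
  | App f a => App f (fun i => join_ground (a i))
  end.

Definition ginst (l : term S V) (s : vars l -> ground_term S) :=
  join_ground (inst s).

Lemma map_leaves_inst (W X : Type) (h : W -> X) (l : term S V)
    (s : vars l -> W) : map_leaves h (inst s) = inst (h \o s).
Proof.
by elim: l s => [//|f a IH] s /=; congr App; apply: funext => i; rewrite IH.
Qed.

Lemma geval_ginst (G : egraph S) (l : term S V) (g : vars l -> ground_term S)
    (s : vars l -> state G) q :
  (forall v, geval (g v) (s v)) -> geval (ginst g) q <-> eval (inst s) q.
Proof.
elim: l g s q => [v|f a IH] g s q gs.
  split=> [gq|/eval_VarE <-]; last exact: gs.
  by rewrite (eval_inj gq (gs _)); apply: eval_var.
have {}IH i p := IH i _ (restrict (@bigcup_sup _ _ i setT _ I) s) p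
  (fun v => gs _).
split=> /eval_AppE [qs eqs tq]; apply: eval_app tq => i; apply/IH;
  exact: eqs.
Qed.

(** A term has a value only if its subterms do. This turns a ground substitution into a substitution
    by states. *)
Lemma geval_ginst_vars (A : automaton S) (l : term S V)
    (g : vars l -> ground_term S) (q : state A) :
  geval (ginst g) q -> forall v, exists p : state A, geval (g v) p.
Proof.
elim: l g q => [x|f a IH] g q.
  move=> gq v; exists q; suff -> : v = SigSub (mem_set (erefl x)) by [].
  by apply: val_inj; case: v => y yx; apply: (set_mem yx).
move=> /eval_AppE [qs eqs _] [v vm].
have [i _ vi] := set_mem vm.
have [p gp] := IH i _ _ (eqs i) (SigSub (mem_set vi)); exists p.
by move: gp; congr (geval (g _) p); apply: val_inj.
Qed.

End GroundInstances.

(** * Universal properties of [T] and [ICO], and models as pre-fixpoints *)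

Section Saturation.
Variables (S : signature) (V : Type) (R : trs S V).
Implicit Types (G H : egraph S).

Lemma identify_hom_le (A B : automaton S) (r : state A -> state A -> Prop)
    (k : state A -> state B) :
  is_hom k -> (forall x y, r x y -> k x = k y) -> identify r [<=] B.
Proof.
move=> hk kr.
have krst x y : Relation_Operators.clos_refl_sym_trans _ r x y -> k x = k y.
  by elim=> [? ? /kr|//|? ? _ ->|? ? ? _ -> _ ->].
have [rep repE] := choice (@ident_class_surj _ A r).
have kE q : k (rep (ident_class r q)) = k q.
  by apply: krst; apply/ident_classP; rewrite -repE.
exists (k \o rep) => f qs q [ps [p [tp -> ->]]] /=.
rewrite kE (_ : _ \o _ = k \o ps); first exact: hk.
by apply: funext => i /=; rewrite kE.
Qed.

Definition match_sound G H (h : state G -> state H) := forall m : ematch R G,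
  eval (map_leaves h (m_term m)) (h (m_root m)).

Lemma node_ex (G : automaton S) (m : ematch R G) u :
  subterm u (m_term m) -> exists s, node m u s.
Proof.
move=> sub; have [->|ne] := pselect (u = m_term m).
  by exists (inl (m_root m)); apply: node_root.
case E : u => [q|g a].
  by exists (inl q); apply: node_state; rewrite -E.
have fr : fresh m u by split=> // q; rewrite E.
exists (inr (existT _ m (SigSub (mem_set fr)))); rewrite -E.
exact: (node_fresh (SigSub (mem_set fr))).
Qed.

(** Flattening forces exactly that each right-hand side evaluates to its root: a fresh state must go
    to the value in [H] of the subterm it stands for. *)
Lemma T_leP G H :
  T R G [<=] H <-> exists2 h : state G -> state H, is_hom h & match_sound h.
Proof.
split=> [[k hk]|[h hh hm]].
  pose c := k \o ident_class (A := flat R G) (@flat_ident S V R G).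
  have hc : @is_hom S (flat R G) H c.
    by move=> f qs q /(@ident_class_hom _ (flat R G) (@flat_ident S V R G)) /hk.
  exists (c \o inl) => [f qs q tq|m].
    by apply: hc; apply: flat_old tq _.
  have : subterm (m_term m) (m_term m) by exact: subterm_refl.
  have := node_root m; rewrite -[(c \o inl) (m_root m)]/(c (inl _)).
  (* The root is generalised to any node, so the induction runs over all subterms. *)
  move: (inl (m_root m)); elim: {1 2 4}(m_term m) => [q|f us IH] s nd sub.
    suff -> : c s = c (inl q) by apply: eval_var.
    move E: (Var q) nd => w nd; case: nd E => [E|p _ [->] //|v E].
      (* Here the right-hand side is a variable, and its state is identified with the root. *)
      congr k; apply/ident_classP.
      apply: Relation_Operators.rst_sym; apply: Relation_Operators.rst_step.
      by exists m, q.
    by case: (set_valP v) => _ _ /(_ q); rewrite -E.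
  have [qs qsP] := choice (fun i => node_ex (subterm_App i sub)).
  apply: (@eval_app _ _ _ _ (c \o qs)) => [i|].
    exact: IH (qsP i) (subterm_App i sub).
  by apply: hc; apply: flat_new sub qsP nd.
(* Since the whole right-hand side has a value in [H], so does each subterm; these values define the
   map on fresh states. *)
have sub_ex (m : ematch R G) u :
    subterm u (m_term m) -> exists q, eval (map_leaves h u) q.
  move: (hm m); move: (h (m_root m)) => q eq sub.
  elim: sub q eq => [|f a i _ IH] q; first by exists q.
  by move=> /eval_AppE [qs eqs _]; apply: IH (eqs i).
have fresh_ex (x : {m : ematch R G & fresh m}) :
    exists q, eval (map_leaves h (val (projT2 x))) q.
  by case: x => m u; apply: (sub_ex m); case: (set_valP u).
have [kf kfP] := choice fresh_ex.
pose k (s : flat_state R G) := match s with inl q => h q | inr x => kf x end.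
have nodeP (m : ematch R G) u s : node m u s -> eval (map_leaves h u) (k s).
  by case=> [|q _|v]; [exact: hm | exact: eval_var | exact: kfP (existT _ m v)].
apply: (@identify_hom_le (flat R G) H (@flat_ident S V R G) k).
  move=> f qs q; case=> [ps p tp ->|m us s _ nds nd]; first exact: hh tp.
  have /eval_AppE [ps eps tp] := nodeP _ _ _ nd.
  suff -> : k \o qs = ps by [].
  by apply: funext => i; apply: eval_inj (nodeP _ _ _ (nds i)) (eps i).
move=> x y [m [c [mE -> ->]]] /=; apply: eval_VarE.
by have := hm m; rewrite mE.
Qed.

Definition rule_sound G H := forall l r (lr : rules R (l, r))
    (g : vars l -> ground_term S) t,
  sim G (ginst g) t -> sim H (ginst (restrict (rules_vars lr) g)) t.

(** Ground substitutions yield state substitutions by evaluation, and reachability provides ground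
    terms in the other direction. *)
Lemma match_soundP G H (h : state G -> state H) :
  is_hom h -> match_sound h <-> rule_sound G H.
Proof.
move=> hh; split=> [hm l r lr g t [q gq tq]|rs [l r lr s c holds]].
  have [s sP] := choice (geval_ginst_vars gq).
  have /eval_rewrites lq : eval (inst s) q by apply/(geval_ginst _ sP).
  have := hm (EMatch lr lq); rewrite /m_term map_leaves_inst /= => rq.
  exists (h q); last exact: geval_hom tq.
  by apply/(geval_ginst (s := h \o restrict (rules_vars lr) s)) => // v;
    apply: geval_hom hh _; apply: sP.
have [g gP] := choice (fun v => @geval_ex _ G (s v)).
have gc : geval (ginst g) c by apply/(geval_ginst _ gP)/rewrites_eval.
(* Taking the left-hand instance itself for [t] pins the common value in [H] to [h c]. *)
have [|q rq lq] := rs l r lr g (ginst g); first by exists c.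
rewrite /m_term map_leaves_inst /=.
apply/(@geval_ginst _ _ _ _ (restrict (rules_vars lr) g)) => [v|].
  by apply: geval_hom hh _; apply: gP.
by rewrite (eval_inj (geval_hom hh gc) lq).
Qed.

Lemma ICO_leP G H : ICO R G [<=] H <-> G [<=] H /\ rule_sound G H.
Proof.
have [Tle Tmin] := CC_spec (T_reachable (R := R) (@egraph_reach _ G)).
split=> [le|[[h hh] rs]].
  have /T_leP [h hh /(match_soundP hh) rs] := hom_le_trans Tle le.
  by split=> //; exists h.
by apply: Tmin; apply/T_leP; exists h => //; apply/match_soundP.
Qed.

Lemma ICO_ge G : G [<=] ICO R G.
Proof. exact: ((ICO_leP _ _).1 (hom_le_refl _)).1. Qed.

(** [rule_sound] is antitone in its first argument. *)
Lemma ICO_mono G H : G [<=] H -> ICO R G [<=] ICO R H.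
Proof.
move=> GH; have [Hle rs] := (ICO_leP _ _).1 (hom_le_refl (ICO R H)).
apply/ICO_leP; split; first exact: hom_le_trans GH Hle.
by move=> l r lr g t /(sim_leP _ _).1 => /(_ _ GH); apply: rs.
Qed.

Lemma ICO_modelP H : is_model_of_trs R H <-> ICO R H [<=] H.
Proof.
have id_hom : @is_hom S H H id by [].
have idE (t : term S (state H)) : map_leaves id t = t.
  by elim: t => [//|f a IH] /=; congr App; apply: funext.
split=> [mod|/ICO_leP [_ /(match_soundP id_hom) ms] l r lr s c holds].
  apply/ICO_leP; split; first exact: hom_le_refl.
  apply/(match_soundP id_hom) => -[l r lr s c holds].
  by rewrite idE; apply: rewrites_eval; apply: mod.
by apply: eval_rewrites; have := ms (EMatch lr holds); rewrite idE.
Qed.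

Lemma iter_ICO_le G H n :
  G [<=] H -> ICO R H [<=] H -> iter n (ICO R) G [<=] H.
Proof.
move=> GH le; elim: n => [//|n IH] /=.
exact: hom_le_trans (ICO_mono IH) le.
Qed.

Lemma EqSat_prefixpoint G E : is_EqSat R G E -> ICO R E [<=] E.
Proof.
move=> lub; apply/ICO_leP; split=> [|l r lr g t]; first exact: hom_le_refl.
move=> /(chain_lub_sim (fun i => ICO_ge _) lub) [i].
(* The match occurs at stage [i]; its consequence holds at stage [i.+1], hence in [E]. *)
have [_ /(_ _ _ lr g t) rs] := (ICO_leP _ _).1 (lub.1 i.+1).
exact: rs.
Qed.

End Saturation.

Theorem theorem19 (S : signature) (V : Type) (R : trs S V) (G : egraph S) :
  [/\ (forall G1 : egraph S, G [<=] G1 -> G [<=] ICO R G1),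
      (forall G1 G2 : egraph S, G [<=] G1 -> G [<=] G2 ->
         G1 [~=] G2 -> ICO R G1 [~=] ICO R G2),
      (exists E : egraph S, is_EqSat R G E) &
      (forall E : egraph S, is_EqSat R G E ->
         is_least_fixpoint (ICO R) G E /\ is_universal_model R G E)].
Proof.
split.
- by move=> G1 le; apply: hom_le_trans le (ICO_ge R G1).
- by move=> G1 G2 _ _ /iso_hom_le [le ge]; apply: hom_le_anti; apply: ICO_mono.
- by apply: chain_lub_exists => i; apply: ICO_ge.
move=> E lub; have pre := EqSat_prefixpoint lub.
have GE : G [<=] E := lub.1 0.
(* Minimality among pre-fixpoints covers both fixpoints and models. *)
have least (H : egraph S) : G [<=] H -> ICO R H [<=] H -> E [<=] H.
  by move=> GH le; apply: lub.2 => i; apply: iter_ICO_le.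
split; split.
- by split=> //; apply: hom_le_anti pre (ICO_ge R E).
- by move=> H [GH /iso_hom_le [le _]]; apply: least.
- by split=> //; apply/ICO_modelP.
- by move=> H [GH /ICO_modelP]; apply: least.
Qed.
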